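(* For $n\ge0$ let $H_n$ be the number of hex trees with $n$ edges. Then $$H_n\equiv\begin{cases}(-1)^{\delta_3^*(m+1)}\pmod 3&\text{if } n=2m \text{ where } m\in T^*(01)-1,\\ 0\pmod 3&\text{otherwise.}\end{cases}$$
   Context: A ternary tree here is a rooted tree in which each vertex has some subset (possibly empty) of three possible children: left, middle, right. A hex tree is a ternary tree in which no vertex has two adjacent children, where a middle child is adjacent to a left and to a right child but left and right children are not adjacent. For $m\in\mathbb{N}$ with base-$3$ expansion $m=m_0+3m_1+9m_2+\cdots$, $T^*(01)$ is the set of $m$ with $m_i\in\{0,1\}$ for all $i\ge1$, and $\delta_3^*(m)$ is the number of indices $i\ge1$ with $m_i=1$. $T^*(01)-1=\{m-1: m\in T^*(01)\}$. *)

(* Defs.v *)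
From HB Require Import structures.
From mathcomp Require Import all_boot all_order all_algebra.

Set Implicit Arguments.
Unset Strict Implicit.
Unset Printing Implicit Defensive.

(* A vertex together with its optional left, middle and right subtrees, so the
   root always exists and the smallest tree, with no edges, is a single
   vertex. *)
Inductive ttree : Type :=
  TNode of option ttree & option ttree & option ttree.

Fixpoint nedges (t : ttree) : nat :=
  let: TNode l m r := t in
  oapp (fun u => (nedges u).+1) 0 l + oapp (fun u => (nedges u).+1) 0 m
    + oapp (fun u => (nedges u).+1) 0 r.

(* The pairs of adjacent children are left/middle and middle/right. *)
Fixpoint is_hex (t : ttree) : bool :=
  let: TNode l m r := t in
  [&& ~~ (isSome l && isSome m), ~~ (isSome m && isSome r),
      oapp is_hex true l, oapp is_hex true m & oapp is_hex true r].

(* The automatically generated principle gives no hypothesis on subtrees. *)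
Lemma ttree_nested_ind (P : ttree -> Prop) :
    (forall l m r, (forall u, l = Some u -> P u) ->
       (forall u, m = Some u -> P u) -> (forall u, r = Some u -> P u) ->
     P (TNode l m r)) ->
  forall t, P t.
Proof.
move=> IH; fix rec 1 => -[l m r]; apply: IH.
- by case: l => [u v [<-]|v]; [exact: rec | discriminate].
- by case: m => [u v [<-]|v]; [exact: rec | discriminate].
- by case: r => [u v [<-]|v]; [exact: rec | discriminate].
Qed.

Fixpoint ttree_encode (t : ttree) : GenTree.tree unit :=
  let: TNode l m r := t in
  GenTree.Node 0 [:: oapp ttree_encode (GenTree.Leaf tt) l;
                     oapp ttree_encode (GenTree.Leaf tt) m;
                     oapp ttree_encode (GenTree.Leaf tt) r].

Fixpoint ttree_decode (g : GenTree.tree unit) : option ttree :=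
  if g is GenTree.Node 0 [:: a; b; c]
  then Some (TNode (ttree_decode a) (ttree_decode b) (ttree_decode c))
  else None.

Lemma ttree_encodeK : pcancel ttree_encode ttree_decode.
Proof.
elim/ttree_nested_ind => l m r IHl IHm IHr /=; congr (Some (TNode _ _ _)).
- by case: l IHl => //= u; apply.
- by case: m IHm => //= u; apply.
- by case: r IHr => //= u; apply.
Qed.

HB.instance Definition _ := Countable.copy ttree (pcan_type ttree_encodeK).

Fixpoint ttrees (h : nat) : seq ttree :=
  if h is h'.+1 then
    let s := None :: map some (ttrees h') in
    [seq TNode p.1.1 p.1.2 p.2
      | p <- [seq (q, r) | q <- [seq (l, m) | l <- s, m <- s], r <- s]]
  else [::].

Lemma mem_ttrees h t : nedges t < h -> t \in ttrees h.
Proof.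
elim: h t => // h IH [l m r]; rewrite ltnS => le_h.
have sub o : oapp (fun u => (nedges u).+1) 0 o <= h ->
    o \in None :: map some (ttrees h).
  case: o => [u|] //= lt_u; rewrite inE /= mem_map; last by move=> ? ? [].
  exact: IH.
apply/mapP; exists ((l, m), r) => //.
apply: allpairs_f; first apply: allpairs_f; apply: sub; apply: leq_trans le_h.
- by rewrite /= -addnA leq_addr.
- by rewrite /= addnAC leq_addl.
- exact: leq_addl.
Qed.

Record hextree (n : nat) := HexTree {
  hextree_val :> ttree;
  _ : is_hex hextree_val && (nedges hextree_val == n)
}.

HB.instance Definition _ n := [isSub for @hextree_val n].
HB.instance Definition _ n := [Countable of hextree n by <:].

Lemma hextree_enumP n :
  Finite.axiom (pmap (insub : ttree -> option (hextree n))
                     (undup (ttrees n.+1))).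
Proof.
apply: Finite.uniq_enumP; first by rewrite pmap_sub_uniq ?undup_uniq.
move=> t; rewrite mem_pmap_sub mem_undup mem_ttrees //.
by have /andP[_ /eqP->] := valP t.
Qed.

HB.instance Definition _ n := isFinite.Build (hextree n) (@hextree_enumP n).

Definition H (n : nat) : nat := #|{: hextree n}|.

Definition digit3 (m i : nat) : nat := (m %/ 3 ^ i) %% 3.

Definition Tstar01 (m : nat) : Prop :=
  forall i, 1 <= i -> digit3 m i = 0 \/ digit3 m i = 1.

(* Since m < 3 ^ i for i >= m, all nonzero digits have index at most m. *)
Definition delta3star (m : nat) : nat :=
  \sum_(1 <= i < m.+1) (digit3 m i == 1).

(* The set T^*(01) - 1: the difference m = k - 1 is taken without truncation,
   so k = 0 contributes no natural number. *)
Definition Tstar01_sub1 (m : nat) : Prop :=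
  exists2 k, Tstar01 k & k = m.+1.

(* Main.v *)
Require Import Defs.
From mathcomp Require Import all_boot all_order all_algebra zify ring.

(* Splitting a hex tree at its root gives H(x) = 1 + 3 x H(x) + x^2 H(x)^2, so
   modulo 3 the series 1 + x^2 H(x) squares to 1 - x^2.  Over F_3 the
   polynomial (1 - x)^2 prod_(1 <= i <= N) (1 - x^(3^i)) squares to
   (1 - x)(1 - x^(3^(N+1))) by Frobenius, so it is a square root of 1 - x up to
   degree 3^(N+1).  As (1 - x)^2 = 1 + x + x^2 over F_3, its coefficients are
   read off the ternary digits of the exponent. *)

Set Implicit Arguments.
Unset Strict Implicit.
Unset Printing Implicit Defensive.

Import GRing.Theory.

(** * Root decomposition of hex trees and the recurrence for [H] *)

Definition hexseq (n : nat) : seq ttree := map val (enum {: hextree n}).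

Lemma mem_hexseq n t : (t \in hexseq n) = is_hex t && (nedges t == n).
Proof.
apply/mapP/idP => [[u _ ->]|Pt]; first exact: (valP u).
by exists (HexTree Pt); rewrite ?mem_enum.
Qed.

Lemma hexseq_uniq n : uniq (hexseq n).
Proof. by rewrite map_inj_uniq ?enum_uniq //; exact: val_inj. Qed.

Lemma size_hexseq n : size (hexseq n) = H n.
Proof. by rewrite size_map -cardE. Qed.

(** Adjacency leaves left with right as the only pair of children, so a root with children has
    either one child, in three positions, or exactly these two. [unary_hexes] and [binary_hexes]
    list the two kinds. *)
Definition unary_hexes (n : nat) : seq ttree :=
  [seq TNode (Some u) None None | u <- hexseq n]
  ++ [seq TNode None (Some u) None | u <- hexseq n]
  ++ [seq TNode None None (Some u) | u <- hexseq n].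

Definition binary_hexes (n : nat) : seq ttree :=
  [seq TNode (Some p.1) None (Some p.2)
    | i <- iota 0 n.+1,
      p <- [seq (u, v) | u <- hexseq i, v <- hexseq (n - i)]].

Lemma unary_hexes_uniq n : uniq (unary_hexes n).
Proof.
have mapU (C : ttree -> ttree) :
    injective C -> uniq [seq C u | u <- hexseq n].
  by move=> C_inj; rewrite (map_inj_uniq C_inj) hexseq_uniq.
rewrite !cat_uniq !mapU /= ?andbT; try by move=> u v [].
apply/andP; split; apply/hasPn => t.
  by rewrite mem_cat => /orP[] /mapP[u _ ->]; apply/mapP; case.
by move=> /mapP[u _ ->]; apply/mapP; case.
Qed.

Lemma binary_hexes_uniq n : uniq (binary_hexes n).
Proof.
apply: allpairs_uniq_dep; first exact: iota_uniq.
  by move=> i _; apply: allpairs_uniq; rewrite ?hexseq_uniq // => -[? ?] [? ?].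
(* The index [i] is recovered from the tree as the number of edges of its left subtree. *)
move=> x y /allpairsPdep[i [p [_ /allpairsP[[u v] [uH _ ->]] ->]]].
move=> /allpairsPdep[j [q [_ /allpairsP[[u' v'] /= [u'H _ ->]] ->]]] /= [eu ev].
move: u'H uH; rewrite -eu -ev !mem_hexseq => /andP[_ /eqP <-].
by case/andP=> _ /eqP <-.
Qed.

(** The final test is the negation of the one in [mem_binary_hexes], so in [HSS] the two lists are
    disjoint and together exhaustive. *)
Lemma mem_unary_hexes n t :
  (t \in unary_hexes n) =
  [&& is_hex t, nedges t == n.+1
    & if t is TNode (Some _) None (Some _) then false else true].
Proof.
rewrite !mem_cat; apply/or3P/idP.
  by case=> /mapP[u + ->]; rewrite mem_hexseq /= ?addn0 ?add0n eqSS !andbT.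
case: t => [[l|] [m|] [r|]] //= /and3P[] //.
- move=> ht nt _; constructor 1; apply: (map_f (fun u => TNode (Some u) None None)).
  by rewrite mem_hexseq; move: ht nt; rewrite !addn0 eqSS !andbT => -> ->.
- move=> ht nt _; constructor 2; apply: (map_f (fun u => TNode None (Some u) None)).
  by rewrite mem_hexseq; move: ht nt; rewrite !addn0 eqSS !andbT => -> ->.
move=> ht nt _; constructor 3; apply: (map_f (fun u => TNode None None (Some u))).
by rewrite mem_hexseq; move: ht nt; rewrite eqSS => -> ->.
Qed.

Lemma mem_binary_hexes n t :
  (t \in binary_hexes n) =
  [&& is_hex t, nedges t == n.+2
    & if t is TNode (Some _) None (Some _) then true else false].
Proof.
apply/allpairsPdep/idP.
  case=> i [_ [+ /allpairsP[[u v] /= [+ + ->]] ->]].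
  rewrite mem_iota !mem_hexseq /= => i_le /andP[-> /eqP ->] /andP[-> /eqP ->].
  by rewrite andbT /=; lia.
case: t => [[u|] [m|] [v|]] //= /and3P[] // /andP[hu hv] nt _.
exists (nedges u), (u, v); split=> //.
  by rewrite -[0 :: _]/(iota 0 n.+1) mem_iota; lia.
apply/allpairsP; exists (u, v); split=> //=; rewrite mem_hexseq ?hu ?hv //=.
by lia.
Qed.

Lemma size_unary_hexes n : size (unary_hexes n) = 3 * H n.
Proof. by rewrite !size_cat !(size_map _ (hexseq n)) size_hexseq; lia. Qed.

Lemma size_binary_hexes n :
  size (binary_hexes n) = \sum_(i < n.+1) H i * H (n - i).
Proof.
rewrite size_allpairs_dep sumnE big_map -/(index_iota 0 n.+1) big_mkord.
by apply: eq_bigr => i _; rewrite size_allpairs !size_hexseq.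
Qed.

Lemma H0 : H 0 = 1.
Proof.
rewrite -size_hexseq (perm_size (_ : perm_eq _ [:: TNode None None None])) //.
apply: uniq_perm => // [|t]; first exact: hexseq_uniq.
rewrite mem_hexseq inE; apply/andP/eqP => [[]|-> //].
by case: t => [[l|] [m|] [r|]] //= _ /eqP; lia.
Qed.

Lemma H1 : H 1 = 3.
Proof.
transitivity (3 * H 0); last by rewrite H0.
rewrite -size_unary_hexes -size_hexseq.
apply: perm_size; apply: uniq_perm => [||t].
- exact: hexseq_uniq.
- exact: unary_hexes_uniq.
rewrite mem_hexseq mem_unary_hexes; congr (_ && _).
by case: t => [[l|] [m|] [r|]] //=; rewrite ?andbT ?andbF //; lia.
Qed.

Lemma HSS n : H n.+2 = 3 * H n.+1 + \sum_(i < n.+1) H i * H (n - i).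
Proof.
rewrite -size_unary_hexes -size_binary_hexes -size_hexseq -size_cat.
apply: perm_size; apply: uniq_perm => [||t].
- exact: hexseq_uniq.
- rewrite cat_uniq unary_hexes_uniq binary_hexes_uniq andbT /=.
  apply/hasPn => t; rewrite /= mem_unary_hexes mem_binary_hexes.
  by case: t => [[l|] [m|] [r|]] //=; rewrite ?andbF.
rewrite mem_cat mem_hexseq mem_unary_hexes mem_binary_hexes.
by case: t => [[l|] [m|] [r|]]; rewrite ?andbF ?andbT ?orbF.
Qed.

Local Open Scope ring_scope.

(** * A truncated square root of 1 - x over F_3 and its coefficients *)

Fixpoint sqrt1BX (N : nat) : {poly 'F_3} :=
  if N is N'.+1 then sqrt1BX N' * (1 - 'X^(3 ^ N)) else (1 - 'X) ^+ 2.

Lemma cube_sub1_char3 (p : {poly 'F_3}) : (1 - p) ^+ 3 = 1 - p ^+ 3.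
Proof.
have p3 : 3%:R = 0 :> {poly 'F_3} by rewrite -polyC_natr (pchar_Fp_0 (p := 3)).
transitivity (1 - p ^+ 3 - 3%:R * (p - p ^+ 2)); first by ring.
by rewrite p3 mul0r subr0.
Qed.

(** The product telescopes: the square of each new factor meets the factor left over from the
    previous stage, and Frobenius turns the resulting cube into the next leftover. *)
Lemma sqrt1BX_sqr N : sqrt1BX N ^+ 2 = (1 - 'X) * (1 - 'X^(3 ^ N.+1)).
Proof.
elim: N => [|N IH] /=.
  by rewrite expn1 -cube_sub1_char3 -exprM -exprS.
rewrite exprMn IH -mulrA -exprS cube_sub1_char3 -exprM.
by rewrite -expnSr.
Qed.

(** For a ternary digit d, the coefficient of y^d in 1 - y. It is applied only to digits of index at
    least 1. *)
Definition digit_weight (d : nat) : 'F_3 :=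
  match d with 0%N => 1 | 1%N => -1 | _ => 0 end.

Lemma digit3_addl_exp r N i : (i <= N)%N ->
  digit3 (3 ^ N.+1 + r) i = digit3 r i.
Proof.
move=> le_iN; rewrite /digit3 -(subnK (leqW le_iN)) expnD divnMDl ?expn_gt0 //.
by rewrite subSn // expnS mulnC modnMDl.
Qed.

(** With M = 3^(N+1), multiplying by 1 - x^M subtracts a copy shifted by M. The degree is below M,
    so the copies do not overlap: the blocks k / M = 0, 1, 2 carry the old coefficients times 1, -1,
    0. *)
Lemma coef_sqrt1BX N k :
  (sqrt1BX N)`_k =
  if (k < 3 ^ N.+1)%N then \prod_(1 <= i < N.+1) digit_weight (digit3 k i)
  else 0.
Proof.
elim: N k => [|N IH] k.
  rewrite big_geq // /=.
  (* Over F_3 the middle coefficient -2 equals 1. *)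
  have -> : (1 - 'X) ^+ 2 = 1 - 'X *+ 2 + 'X^2 :> {poly 'F_3} by ring.
  by rewrite !coefE; case: k => [|[|[|k]]] //=; apply/eqP.
rewrite big_nat_recr //= mulrBr mulr1 coefB coefMXn !IH.
have -> : digit3 k N.+1 = ((k %/ 3 ^ N.+1) %% 3)%N by [].
have digits : (3 ^ N.+1 <= k)%N ->
    \prod_(1 <= i < N.+1) digit_weight (digit3 (k - 3 ^ N.+1) i) =
    \prod_(1 <= i < N.+1) digit_weight (digit3 k i).
  move=> le_k; apply: eq_big_nat => i /andP[_ lt_i].
  by rewrite -{2}(subnKC le_k) digit3_addl_exp.
rewrite (expnS 3 N.+1); set M := (3 ^ N.+1)%N in digits *.
have M0 : (0 < M)%N by rewrite expn_gt0.
have [lt_k|le_k] := ltnP k M.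
  by rewrite divn_small // subr0 mulr1 (leq_trans lt_k) ?leq_pmull.
rewrite digits //; have [lt_k|le2_k] := ltnP (k - M) M.
  have -> : (k %/ M = 1)%N.
    by rewrite -(subnKC le_k) -{1}[M]mul1n divnMDl // divn_small.
  by rewrite ifT ?sub0r ?mulrN1 //; lia.
rewrite subrr; case: ltnP => // lt_k.
have -> : (k %/ M = 2)%N; last by rewrite mulr0.
by rewrite -(subnKC (_ : 2 * M <= k)%N) ?divnMDl ?divn_small //; lia.
Qed.

Lemma coef_sqrt1BX_lt3 N k : (k < 3)%N -> (sqrt1BX N)`_k = 1.
Proof.
move=> lt_k3; have le3M : (3 <= 3 ^ N.+1)%N by rewrite -{1}[3%N]expn1 leq_pexp2l.
rewrite coef_sqrt1BX (leq_trans lt_k3) // big_nat big1 // => i /andP[i1 _].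
rewrite /digit3 divn_small ?mod0n //; apply: (leq_trans lt_k3).
by rewrite -{1}[3%N]expn1 leq_pexp2l.
Qed.

(* Encodes sqrt1BX N (x^2) = 1 + x^2 \sum_n hexsol N n x^n. *)
Definition hexsol (N n : nat) : 'F_3 := (sqrt1BX N \Po 'X^2)`_n.+2.

(** * Comparison of [H] modulo 3 with the square root *)

Lemma hexsolE N n :
  hexsol N n = if odd n then 0 else (sqrt1BX N)`_(n./2.+1).
Proof.
rewrite /hexsol coef_comp_poly_Xn // dvdn2 divn2 /= negbK.
by case: (odd n).
Qed.

(** Compare coefficients of x^(n+4) in F^2 = (1 - x^2)(1 - x^(2 * 3^(N+1))): the bound makes the
    right side vanish. *)
Lemma hexsolSS N n : (n.+4 < 2 * 3 ^ N.+1)%N ->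
  hexsol N n.+2 = \sum_(i < n.+1) hexsol N i * hexsol N (n - i).
Proof.
move=> lt_n; rewrite /hexsol; set F := sqrt1BX N \Po 'X^2.
have F0 : F`_0 = 1 by rewrite coef_comp_poly_Xn //= coef_sqrt1BX_lt3.
have F1 : F`_1 = 0 by rewrite coef_comp_poly_Xn.
have F2 : F * F = (1 - 'X^2) * (1 - 'X^(2 * 3 ^ N.+1)).
  rewrite -expr2 /F -rmorphXn sqrt1BX_sqr rmorphM !rmorphB rmorph1 /=.
  by rewrite comp_polyX comp_Xn_poly -exprM.
have := congr1 (fun p : {poly 'F_3} => p`_n.+4) F2.
have -> : ((1 - 'X^2) * (1 - 'X^(2 * 3 ^ N.+1)) : {poly 'F_3})`_n.+4 = 0.
  by rewrite mulrBr mulr1 coefB coefMXn lt_n !coefE /= !subr0.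
(* The outermost terms each give F_(n+4), the next two contain F_1 = 0, and the rest is the required
   convolution, shifted by 2 in each index. *)
rewrite coefM 2!big_ord_recl 2!big_ord_recr /= /bump /= !add1n !subn0.
rewrite (_ : n.+4 - n.+3 = 1)%N ?subnn ?F0; last by lia.
rewrite F1 mul1r mul0r mulr0 mulr1 add0r addr0.
set S := \sum_(i < n.+1) _; set T := \sum_(i < n.+1) _.
have -> : S = T.
  apply: eq_bigr => i _; rewrite !add1n !subSS.
  by have le_in : (i <= n)%N; [rewrite -ltnS | rewrite !subSn // ltnW].
move=> eq0; have p3 : 3%:R = 0 :> 'F_3 by exact: (pchar_Fp_0 (p := 3)).
(* From 2 F_(n+4) + T = 0 follows F_(n+4) = T, since 2 = -1 in F_3. *)
transitivity (3%:R * F`_n.+4 - (F`_n.+4 + (T + F`_n.+4)) + T); first by ring.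
by rewrite p3 mul0r eq0 subrr add0r.
Qed.

(** Modulo 3 the term 3 [H n.+1] of [HSS] disappears, so both sequences start 1, 0 and obey the same
    recurrence. *)
Lemma H_F3 N n : (n.+2 < 2 * 3 ^ N.+1)%N -> (H n)%:R = hexsol N n.
Proof.
elim/ltn_ind: n => -[|[|n]] IH lt_n.
- by rewrite H0 hexsolE /= coef_sqrt1BX_lt3.
- by rewrite H1 hexsolE /= (pchar_Fp_0 (p := 3)).
rewrite HSS hexsolSS // natrD natrM (pchar_Fp_0 (p := 3)) // mul0r add0r.
rewrite natr_sum; apply: eq_bigr => i _; have lt_i := ltn_ord i.
by rewrite natrM !IH //; lia.
Qed.

Lemma H_odd_F3 n : odd n -> (H n)%:R = 0 :> 'F_3.
Proof.
move=> odd_n; rewrite (@H_F3 n) ?hexsolE ?odd_n //.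
have := ltn_expl n.+1 (isT : 1 < 3)%N; lia.
Qed.

Lemma H_even_F3 m :
  (H (2 * m))%:R = \prod_(1 <= i < m.+2) digit_weight (digit3 m.+1 i).
Proof.
(* Taking N = m + 1 is large enough and gives the product the index range of [delta3star m.+1]. *)
have lt_m : (m.+1 < 3 ^ m.+2)%N by apply: ltnW; apply: ltn_expl.
rewrite (@H_F3 m.+1); last by lia.
by rewrite hexsolE mul2n odd_double doubleK coef_sqrt1BX lt_m.
Qed.

(** * Evaluation of the digit product and the two cases *)

Lemma digit3_eq0 m i : (m < i)%N -> digit3 m i = 0%N.
Proof.
move=> lt_mi; rewrite /digit3 divn_small ?mod0n //.
by apply: (ltn_trans lt_mi); apply: ltn_expl.
Qed.

Lemma prod_digit_weight m : Tstar01 m ->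
  \prod_(1 <= i < m.+1) digit_weight (digit3 m i) = (-1) ^+ delta3star m.
Proof.
move=> Tm; rewrite /delta3star expr_sum.
apply: eq_big_nat => i /andP[i_gt0 _].
by case: (Tm i i_gt0) => ->.
Qed.

(** By contraposition: a nonzero product excludes the digit 2 at every index from 1 to m, and digits
    of larger index are 0. *)
Lemma prod_digit_weight_eq0 m : ~ Tstar01 m ->
  \prod_(1 <= i < m.+1) digit_weight (digit3 m i) = 0.
Proof.
move=> nTm; apply/eqP; apply: contra_notT nTm => prod_neq0 i i_gt0.
have [lt_im|le_mi] := ltnP i m.+1; last by left; exact: digit3_eq0.
move: prod_neq0; rewrite big_mkcond prodf_seq_neq0 => /allP/(_ i).
have : (digit3 m i < 3)%N by rewrite ltn_mod.
rewrite mem_index_iota i_gt0 lt_im.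
by case: (digit3 m i) => [|[|[|]]] // _; [left|right|move=> /(_ isT)/eqP].
Qed.

Lemma F3_intr_inj (a b : int) : a%:~R = b%:~R :> 'F_3 -> (a = b %[mod 3])%Z.
Proof.
move=> eq_ab; apply/eqP.
rewrite eqz_mod_dvd (dvdz_pcharf (pchar_Fp (isT : prime 3))).
by rewrite rmorphB /= eq_ab subrr.
Qed.

Local Close Scope ring_scope.

Theorem theorem5p3 (n : nat) :
  (forall m : nat, n = 2 * m -> Tstar01_sub1 m ->
     (Posz (H n) = (-1) ^+ delta3star m.+1 %[mod 3])%Z%R)
  /\
  ((~ exists m : nat, n = 2 * m /\ Tstar01_sub1 m) ->
     (Posz (H n) = 0 %[mod 3])%Z%R).
Proof.
split=> [m -> [k Tk km]|not_even]; apply: F3_intr_inj; rewrite -pmulrn.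
  by rewrite H_even_F3 prod_digit_weight -?km // rmorphXn rmorphN1.
(* Outside the first case, n is odd, or n = 2m with m + 1 not in T^*(01). *)
have [odd_n|even_n] := boolP (odd n); first exact: H_odd_F3.
rewrite -(even_halfK even_n) -mul2n H_even_F3 prod_digit_weight_eq0 //.
move=> Tn; apply: not_even; exists n./2; split; last by exists n./2.+1.
by rewrite mul2n even_halfK.
Qed.
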